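(* There exists a graph on four vertices such that it is not possible on a radical computation tree to construct the coordinates of every possible Fruchterman and Reingold equilibrium of the graph.
   Context: Points of the plane are identified with complex numbers. An algebraic computation tree is a rooted tree whose computation nodes compute a value as the sum, difference, product or quotient of integer constants and values computed at ancestor nodes, and whose decision nodes test whether a previously computed value is greater than zero and branch accordingly. A radical computation tree additionally allows computing the $k$-th root of a previously computed value (with $k$ an integer parameter of the operation) and complex conjugation. Fruchterman--Reingold model (scale constant $k=1$): each vertex is pulled toward each neighbour by a force of magnitude $d^2$ and pushed away from every other vertex by a force of magnitude $1/d$, $d$ the distance; a Fruchterman and Reingold equilibrium is a drawing with distinct vertex positions in which the total force at every vertex is zero. *)

(* Defs.v *)
(* points of the plane are complex numbers R[i] over the
   real numbers R : realType (mathcomp-analysis) ; R[i] is the complex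
   field of mathcomp-real-closed. *)
From HB Require Import structures.
From mathcomp Require Import all_boot all_order all_algebra.
From mathcomp Require Import reals.
From mathcomp.real_closed Require Import complex.

Set Implicit Arguments.
Unset Strict Implicit.
Unset Printing Implicit Defensive.

Import Order.TTheory GRing.Theory Num.Theory.
Local Open Scope ring_scope.

Definition simple_graph (V : finType) (G : rel V) : Prop :=
  (forall u v, G u v = G v u) /\ (forall v, ~~ G v v).

(* Fruchterman--Reingold model with scale constant k = 1.             *)
(* Total force on vertex v of the drawing p : V -> R[i]:              *)
(*  attraction toward each neighbour u, magnitude d^2 :               *)
(*     d^2 * (p u - p v)/d = d * (p u - p v)                           *)
(*  repulsion from every other vertex u, magnitude 1/d :              *)
(*     (1/d) * (p v - p u)/d = (p v - p u)/d^2                         *)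
Definition FR_force (R : realType) (V : finType) (G : rel V)
    (p : V -> R[i]) (v : V) : R[i] :=
  \sum_(u | G v u) `|p u - p v| * (p u - p v)
  + \sum_(u | u != v) (p v - p u) / `|p v - p u| ^+ 2.

Definition FR_equilibrium (R : realType) (V : finType) (G : rel V)
    (p : V -> R[i]) : Prop :=
  injective p /\ forall v, FR_force G p v = 0.

Definition isometry (R : realType) (f : R[i] -> R[i]) : Prop :=
  forall a b, `|f a - f b| = `|a - b|.

Definition congruent (R : realType) (V : finType) (p q : V -> R[i]) : Prop :=
  exists f : R[i] -> R[i], isometry f /\ forall v, q v = f (p v).

(* Radical computation trees (no input: the graph is fixed).          *)
(* Computed values are stored in a list; operands refer to the        *)
(* indices of previously computed values (ancestor nodes).            *)
Inductive rop : Type :=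
  | OConst of int
  | OAdd of nat & nat
  | OSub of nat & nat
  | OMul of nat & nat
  | ODiv of nat & nat
  | ORoot of nat & nat
  | OConj of nat.

Inductive rtree : Type :=
  | RLeaf of seq nat
  | RComp of rop & rtree
  | RDec of nat & rtree & rtree.

Definition rop_step (R : realType) (vs : seq R[i]) (o : rop) (w : R[i])
  : Prop :=
  match o with
  | OConst z => w = z%:~R
  | OAdd i j => [/\ (i < size vs)%N, (j < size vs)%N & w = vs`_i + vs`_j]
  | OSub i j => [/\ (i < size vs)%N, (j < size vs)%N & w = vs`_i - vs`_j]
  | OMul i j => [/\ (i < size vs)%N, (j < size vs)%N & w = vs`_i * vs`_j]
  | ODiv i j => [/\ (i < size vs)%N, (j < size vs)%N, vs`_j != 0
                   & w = vs`_i / vs`_j]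
  | ORoot k i => [/\ (0 < k)%N, (i < size vs)%N & w ^+ k = vs`_i]
  | OConj i => (i < size vs)%N /\ w = (vs`_i)^*
  end.

Inductive rruns (R : realType) : seq R[i] -> rtree -> seq R[i] -> Prop :=
  | rruns_leaf vs s :
      all (fun i => (i < size vs)%N) s ->
      rruns vs (RLeaf s) [seq vs`_i | i <- s]
  | rruns_comp vs o t w out :
      rop_step vs o w -> rruns (rcons vs w) t out ->
      rruns vs (RComp o t) out
  | rruns_dec_pos vs i tp tn out :
      (i < size vs)%N -> 0 < vs`_i -> rruns vs tp out ->
      rruns vs (RDec i tp tn) out
  | rruns_dec_npos vs i tp tn out :
      (i < size vs)%N -> ~~ (0 < vs`_i) -> rruns vs tn out ->
      rruns vs (RDec i tp tn) out.

Definition rconstructs (R : realType) (n : nat) (t : rtree)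
    (q : 'I_n -> R[i]) : Prop :=
  rruns [::] t [seq q v | v <- enum 'I_n].

(* Main.v *)
Require Import Defs.
From HB Require Import structures.
From mathcomp Require Import all_boot all_order all_algebra.
From mathcomp Require Import all_fingroup all_solvable all_field.
From mathcomp Require Import reals zify ring lra.
From mathcomp.real_closed Require Import complex.
From mathcomp.real_closed Require polyrcf.
Set Implicit Arguments.
Unset Strict Implicit.
Unset Printing Implicit Defensive.
Import Order.TTheory GRing.Theory Num.Theory.
Local Open Scope ring_scope.

(* Put K_4 minus an edge on a line, symmetrically: the endpoints of the missing
   edge at -tx and tx, the other two vertices at -x and x. Equilibrium means
   8 (t^2 - 1) (t + 1) x^3 = t^2 - 5 together with
   t^5 - 14 t^3 - 10 t^2 - 3 t + 2 = 0, and this quintic has a root t > 4.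
   It is irreducible over Q with exactly two non-real roots, so its Galois group
   is S_5. As t is a ratio of two distances, a radical computation tree for a
   congruent drawing would make t a radical number.

   Radical numbers are handled without towers of fields. Let G be the Galois
   group of a sufficiently large number field. All commutators of G fix the
   roots of unity; if w^k and the k-th roots of unity are fixed by a subgroup
   H, then H acts on w through commuting scalings, hence [H, H] fixes w. So
   every radical number is fixed by some term of the derived series of G. If t
   were fixed by such a term, which is normal, so would be all its conjugates,
   and S_5 would be solvable. *)

(** * Number fields inside the complex numbers *)

Lemma map_in_alg_rmorph (L : fieldExtType rat) (C : numFieldType)
    (iota : {rmorphism L -> C}) (p : {poly rat}) :
  map_poly iota (map_poly (in_alg L) p) = map_poly ratr p.
Proof.
rewrite -map_poly_comp; apply: eq_map_poly => a /=.
by rewrite alg_num_field fmorph_rat.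
Qed.

Lemma map_prod_XsubC (F : nzRingType) (K : comNzRingType) (f : {rmorphism F -> K})
    (rs : seq F) :
  map_poly f (\prod_(z <- rs) ('X - z%:P)) = \prod_(z <- map f rs) ('X - z%:P).
Proof.
elim: rs => [|z rs IH]; first by rewrite !big_nil rmorph1.
by rewrite /= !big_cons rmorphM /= map_polyXsubC IH.
Qed.

Lemma num_field_pchar0 (L : fieldExtType rat) : [pchar L] =i pred0.
Proof. by move=> p; rewrite pchar_lalg pchar_num. Qed.

(** Primitive element theorem: characteristic zero makes the extension separable. *)
Lemma num_field_primitive (L : fieldExtType rat) :
  exists z : L, forall x, exists p : {poly rat}, x = (map_poly (in_alg L) p).[z].
Proof.
have sepL : separable 1 {:L}.
  by apply/separableP => x _; apply: pcharf0_separable; exact: num_field_pchar0.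
exists (separable_generator 1 {:L}) => x.
have: x \in <<1; separable_generator 1 {:L}>>%VS.
  by rewrite -(eq_adjoin_separable_generator sepL) ?sub1v ?memvf.
by case/Fadjoin_polyP => q /polyOver1P [p ->] ->; exists p.
Qed.

(** The generator goes to a root [y] in [C] of its minimal polynomial; by [evalE] the value at [y]
    does not depend on the polynomial that represents an element. *)
Lemma num_field_embed (L : fieldExtType rat) (C : numClosedFieldType) :
  inhabited {rmorphism L -> C}.
Proof.
have [z gen_z] := num_field_primitive L.
pose pol x := sval (sig_eqW (gen_z x)).
have polE x : (map_poly (in_alg L) (pol x)).[z] = x.
  by rewrite /pol; case: (sig_eqW _).
have /polyOver1P [m Dm] : minPoly 1 z \is a polyOver 1%VS by exact: minPolyOver.
have [y my0] : exists y, root (map_poly (@ratr C) m) y.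
  apply/closed_rootP; rewrite size_map_poly -(size_map_poly (in_alg L)) -Dm.
  by rewrite size_minPoly.
have evalE p q : (map_poly (in_alg L) p).[z] = (map_poly (in_alg L) q).[z] ->
    (map_poly ratr p).[y] = (map_poly ratr q).[y] :> C.
  move=> Epq; apply/eqP; rewrite -subr_eq0 -hornerN -hornerD -rmorphB.
  rewrite -/(root _ y) !root_factor_theorem in my0 *; apply: dvdp_trans my0 _.
  rewrite dvdp_map -(dvdp_map (in_alg L)) -Dm minPoly_dvdp //.
    by apply/polyOver1P; exists (p - q).
  by rewrite rmorphB /root hornerD hornerN Epq subrr.
pose iota x : C := (map_poly ratr (pol x)).[y].
have iotaB : zmod_morphism iota.
  move=> u v; rewrite /iota -hornerN -hornerD -rmorphB; apply: evalE.
  by rewrite rmorphB hornerD hornerN !polE.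
have iotaM : monoid_morphism iota.
  split=> [|u v]; last first.
    rewrite /iota -hornerM -rmorphM; apply: evalE.
    by rewrite rmorphM hornerM !polE.
  transitivity ((map_poly (@ratr C) 1).[y]).
    by apply: evalE; rewrite polE rmorph1 hornerC.
  by rewrite rmorph1 hornerC.
pose iB := GRing.isZmodMorphism.Build L C iota iotaB.
pose iM := GRing.isMonoidMorphism.Build L C iota iotaM.
by exists; exact: (HB.pack iota iB iM : {rmorphism L -> C}).
Qed.

(** * Splitting fields of rational polynomials *)

Definition splits (L : fieldExtType rat) (g : {poly rat}) :=
  exists rs : seq L, map_poly (in_alg L) g %= \prod_(z <- rs) ('X - z%:P).

Lemma splits_dvd (L : fieldExtType rat) (g h : {poly rat}) :
  h %| g -> splits L g -> splits L h.
Proof.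
rewrite -(dvdp_map (in_alg L)) => hg [rs Dg].
have /dvdp_prod_XsubC [m Dh] :
    map_poly (in_alg L) h %| \prod_(z <- rs) ('X - z%:P).
  by rewrite -(eqp_dvdr _ Dg).
by exists (mask m rs).
Qed.

Lemma splits_root (L : fieldExtType rat) (C : numFieldType)
    (iota : {rmorphism L -> C}) (g : {poly rat}) (x : C) :
  splits L g -> root (map_poly ratr g) x -> exists z, iota z = x.
Proof.
case=> rs Dg; rewrite -(map_in_alg_rmorph iota).
rewrite -(eqp_map iota) in Dg.
rewrite (eqp_root Dg) map_prod_XsubC root_prod_XsubC.
by case/mapP => z _ ->; exists z.
Qed.

Lemma splitting_field_exists (g : {poly rat}) : g != 0 ->
  exists L : splittingFieldType rat, splits L g.
Proof.
move=> nz_g; have [rs Dg] := closed_field_poly_normal (map_poly ratr g : {poly algC}).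
have [L [LC [s Ds genL]]] := num_field_exists rs.
have Lg : map_poly (in_alg L) g %= \prod_(z <- s) ('X - z%:P).
  rewrite -(eqp_map LC) map_in_alg_rmorph Dg map_prod_XsubC Ds.
  by rewrite eqp_scale // lead_coef_eq0 map_poly_eq0.
have axL : SplittingField.axiom L.
  exists (map_poly (in_alg L) g); first by apply/polyOver1P; exists g.
  by exists s.
pose LS := FieldExt_isSplittingField.Build rat L axL.
pose L' : splittingFieldType rat := HB.pack L LS.
by exists L', s.
Qed.

(** * Radical numbers and the derived series *)

(* Complex conjugation need not be a constructor: see [radical_conj]. *)
Inductive radical (C : numClosedFieldType) : C -> Prop :=
  | radical_int (n : int) : radical n%:~R
  | radicalD x y : radical x -> radical y -> radical (x + y)
  | radicalB x y : radical x -> radical y -> radical (x - y)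
  | radicalM x y : radical x -> radical y -> radical (x * y)
  | radicalV x : radical x -> radical x^-1
  | radical_root k x : (0 < k)%N -> radical (x ^+ k) -> radical x.

Lemma radical_conj (C : numClosedFieldType) (x : C) : radical x -> radical x^*.
Proof.
elim=> {x} [n|x y _ rx _ ry|x y _ rx _ ry|x y _ rx _ ry|x _ rx|k x k_gt0 _ rx].
- by rewrite rmorph_int; exact: radical_int.
- by rewrite rmorphD; exact: radicalD.
- by rewrite rmorphB; exact: radicalB.
- by rewrite rmorphM; exact: radicalM.
- by rewrite fmorphV; exact: radicalV.
- by apply: (radical_root k_gt0); rewrite -rmorphXn.
Qed.

(** Once the annihilating polynomial splits in [L], a root extracted in [C] has a preimage in
    [L]. *)
Lemma radical_algebraic (C : numClosedFieldType) (x : C) :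
  radical x -> algebraicOver (@ratr C) x.
Proof.
elim=> {x} [n|x y _ ax _ ay|x y _ ax _ ay|x y _ ax _ ay|x _ ax|k x k_gt0 _ [h nz_h hx]].
- by rewrite -(ratr_int C); exact: algebraic_id.
- exact: algebraic_add.
- exact: algebraic_sub.
- exact: algebraic_mul.
- exact: algebraic_inv.
- exists (h \Po 'X^k).
    by rewrite comp_poly_eq0 // size_polyXn ltnS.
  by rewrite map_comp_poly map_polyXn /root horner_comp hornerXn.
Qed.

(** In characteristic zero ['X^k - 1] is separable, so it has [k] distinct roots, which forces a
    primitive one. *)
Lemma splits_prim_root (L : fieldExtType rat) k : (0 < k)%N ->
  splits L ('X^k - 1) -> exists z : L, k.-primitive_root z.
Proof.
move=> k_gt0 [rs]; rewrite rmorphB rmorph1 /= map_polyXn => Drs.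
have /hasP [z _ prim_z] : has k.-primitive_root rs.
  apply: has_prim_root => //.
  - by apply/allP => z; rewrite -root_prod_XsubC -(eqp_root Drs).
  - rewrite -separable_prod_XsubC -(eqp_separable Drs) separable_Xn_sub_1 //.
    by have /pcharf0P -> := num_field_pchar0 L; rewrite -lt0n.
  - have /eqP := eqp_size Drs; rewrite size_prod_XsubC size_XnsubC //.
    by rewrite eqSS => /eqP ->.
by exists z.
Qed.

Section RadicalExtension.

Variables (L : splittingFieldType rat).
Let G := ('Gal({:L} / 1))%G.

Lemma der_fixedFieldS m n : (m <= n)%N ->
  (fixedField (G^`(m))%g <= fixedField (G^`(n))%g)%VS.
Proof.
move=> le_mn; apply: fixedFieldS.
elim: n le_mn => [|n IH]; first by rewrite leqn0 => /eqP ->.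
rewrite leq_eqVlt ltnS => /predU1P [-> // | /IH]; exact/subset_trans/der_subS.
Qed.

(** Products of automorphisms apply the left factor first; with these inverses the commutator is
    [(g * h) * (h * g)^-1]. *)
Lemma gal_commg_fix (g h : gal_of {:L}) (x : L) :
  g (h x) = h (g x) -> [~ g^-1, h^-1]%g x = x.
Proof.
move=> ghC; have E (a b : gal_of {:L}) y : (a * b)%g y = b (a y).
  by rewrite galM ?memvf.
have -> : [~ g^-1, h^-1]%g = ((g * h) * (h * g)^-1)%g.
  by rewrite commgEl conjgE !invgK invMg !mulgA.
have Ex : (g * h)%g x = (h * g)%g x by rewrite !E.
by rewrite E Ex -E mulgV gal_id.
Qed.

(** Commutators fix [x] by [gal_commg_fix]; the Galois connection for the field generated by [x]
    extends this to the group they generate. *)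
Lemma mem_fixedField_der1 (H : {group gal_of {:L}}) (x : L) :
  {in H &, forall g h : gal_of {:L}, g (h x) = h (g x)} -> x \in fixedField (H^`(1))%g.
Proof.
move=> Hx; have Kx : x \in <<1; x>>%VS by exact: memv_adjoin.
apply: subvP Kx; rewrite -galois_connection ?subvf // gen_subG.
rewrite galois_connection ?subvf //; apply/FadjoinP; split.
  apply/subvP => _ /vlineP [a ->]; apply/fixedFieldP=> [|g _]; rewrite ?memvf //.
  by rewrite linearZ rmorph1.
apply/fixedFieldP; rewrite ?memvf // => _ /imset2P [g h Hg Hh ->].
by rewrite -(invgK g) -(invgK h); apply/gal_commg_fix/Hx; rewrite groupV.
Qed.

(** Automorphisms send [z] to powers of itself, and power maps commute. *)
Lemma prim_root_fixed (z : L) k :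
  k.-primitive_root z -> z \in fixedField (G^`(1))%g.
Proof.
move=> prim_z; apply: mem_fixedField_der1 => g h _ _.
have pow (a : gal_of {:L}) : exists i, a z = z ^+ i.
  have /(prim_rootP prim_z) [i ->] : a z ^+ k = 1.
    by rewrite -rmorphXn prim_expr_order ?rmorph1.
  by exists i.
have [[i Di] [j Dj]] := (pow g, pow h).
by rewrite Dj Di !rmorphXn /= Di Dj -!exprM mulnC.
Qed.

(** As [n] is positive, the n-th derived group fixes [z] as well as [w ^+ k]. Its elements therefore
    multiply [w] by powers of [z], and such scalings commute. *)
Lemma root_fixed (z w : L) k n : (0 < n)%N -> k.-primitive_root z ->
  w ^+ k \in fixedField (G^`(n))%g -> w \in fixedField (G^`(n.+1))%g.
Proof.
move=> n_gt0 prim_z fix_wk; have [-> | nz_w] := eqVneq w 0; first exact: mem0v.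
have fix_z := subvP (der_fixedFieldS n_gt0) _ (prim_root_fixed prim_z).
have [_ {}fix_z] := mem_fixedFieldP fix_z.
have [_ {}fix_wk] := mem_fixedFieldP fix_wk.
apply: (@mem_fixedField_der1 [group of G^`(n)%g]) => g h Hg Hh.
have pow (a : gal_of {:L}) : a \in G^`(n)%g -> exists i, a w = z ^+ i * w.
  move=> Ha; have /(prim_rootP prim_z) [i Di] : (a w / w) ^+ k = 1.
    rewrite exprMn exprVn -rmorphXn /= fix_wk // divff // expf_neq0 //.
  by exists i; rewrite -Di divfK.
have [[i Di] [j Dj]] := (pow g Hg, pow h Hh).
by rewrite Dj Di !rmorphM !rmorphXn /= Di Dj !fix_z // !mulrA (mulrC (z ^+ i)).
Qed.

End RadicalExtension.

(* [splits L g] says that L is large enough; L itself cannot be fixed here,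
   since it must grow with the expression of x. *)
Definition der_fixed (C : numClosedFieldType) (x : C) :=
  exists2 g : {poly rat}, g != 0 & exists n,
  forall (L : splittingFieldType rat) (iota : {rmorphism L -> C}), splits L g ->
  exists2 z, iota z = x & z \in fixedField ('Gal({:L} / 1)^`(n))%g.

(** A field splitting the product of the two polynomials splits both, and the larger index serves
    both since the fixed fields increase. [op] ranges over all fields so as to make sense in [L] and
    in [C]. *)
Lemma der_fixed_op (C : numClosedFieldType) (op : forall K : fieldType, K -> K -> K)
    (x y : C) :
  (forall (L : splittingFieldType rat) (K : {subfield L}),
     {in K &, forall a b, op L a b \in K}) ->
  (forall (L : splittingFieldType rat) (iota : {rmorphism L -> C}) a b,
     iota (op L a b) = op C (iota a) (iota b)) ->
  der_fixed x -> der_fixed y -> der_fixed (op C x y).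
Proof.
move=> opK opM [g nz_g [m fix_g]] [h nz_h [n fix_h]].
exists (g * h); first by rewrite mulf_neq0.
exists (maxn m n) => L iota Lgh.
have [a Da Fa] := fix_g L iota (splits_dvd (dvdp_mulr h (dvdpp g)) Lgh).
have [b Db Fb] := fix_h L iota (splits_dvd (dvdp_mull g (dvdpp h)) Lgh).
exists (op L a b); first by rewrite opM Da Db.
apply: (opK L (fixedField_aspace ('Gal({:L} / 1)^`(maxn m n))%g)).
- exact: subvP (der_fixedFieldS L (leq_maxl m n)) _ Fa.
- exact: subvP (der_fixedFieldS L (leq_maxr m n)) _ Fb.
Qed.

Lemma radical_der_fixed (C : numClosedFieldType) (x : C) : radical x -> der_fixed x.
Proof.
elim=> {x} [n|x y _ rx _ ry|x y _ rx _ ry|x y _ rx _ ry|x _ rx|k x k_gt0 rxk].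
- exists 1; first exact: oner_neq0.
  by exists 0 => L iota _; exists n%:~R; rewrite ?rmorph_int ?rpred_int.
- apply: (der_fixed_op (op := fun K => +%R)) rx ry => [L K a b|L iota a b].
    exact: rpredD.
  exact: rmorphD.
- apply: (der_fixed_op (op := fun K a b => a - b)) rx ry => [L K a b|L iota a b].
    exact: rpredB.
  exact: rmorphB.
- apply: (der_fixed_op (op := fun K => *%R)) rx ry => [L K a b|L iota a b].
    exact: rpredM.
  exact: rmorphM.
(* Inversion is passed as a binary operation that ignores its second argument. *)
- apply: (der_fixed_op (op := fun K a b => a^-1) (y := x) _ _ rx rx)
    => [L K a b|L iota a b].
    by move=> Ka _; rewrite rpredV.
  exact: fmorphV.
have [h nz_h hx] := radical_algebraic (radical_root k_gt0 rxk).
(* The factor [g] handles [x ^+ k], [h] puts [x] in the field, and the last factor supplies a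
   primitive k-th root of unity. *)
case=> g nz_g [n fix_g]; exists (g * h * ('X^k - 1)).
  by rewrite !mulf_neq0 // -size_poly_eq0 size_XnsubC.
(* [maxn n 1] secures the positive index that [root_fixed] requires. *)
exists (maxn n 1).+1 => L iota Lp.
have Lgh := splits_dvd (dvdp_mulr ('X^k - 1) (dvdpp (g * h))) Lp.
have [a Da Fa] := fix_g L iota (splits_dvd (dvdp_mulr h (dvdpp g)) Lgh).
have [w Dw] := splits_root iota (splits_dvd (dvdp_mull g (dvdpp h)) Lgh) hx.
have [z prim_z] := splits_prim_root k_gt0 (splits_dvd (dvdp_mull (g * h) (dvdpp _)) Lp).
exists w => //; apply: (root_fixed _ prim_z); first by rewrite leq_maxr.
apply: subvP (der_fixedFieldS L (leq_maxl n 1)) _ _.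
by rewrite (_ : w ^+ k = a) //; apply: (fmorph_inj iota); rewrite rmorphXn Da Dw.
Qed.

(** * Irreducible polynomials of prime degree with two non-real roots *)

Section PrimeDegree.

Variables (L : splittingFieldType rat) (f : {poly rat}) (n : nat).
Variable alpha : 'I_n -> L.
Hypotheses (irr_f : irreducible_poly f) (alpha_inj : injective alpha).
Hypothesis Df : map_poly (in_alg L) f %= \prod_i ('X - (alpha i)%:P).

Let G := ('Gal({:L} / 1))%G.

Let rootE (x : L) : reflect (exists i, x = alpha i) (root (map_poly (in_alg L) f) x).
Proof.
rewrite (eqp_root Df) -(big_map alpha xpredT (fun z => 'X - z%:P)) root_prod_XsubC.
by apply: (iffP mapP) => [[i _ ->] | [i ->]]; exists i; rewrite ?mem_index_enum.
Qed.

(** By irreducibility [f] is, up to a scalar, the minimal polynomial of each of its roots; normality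
    does the rest. *)
Lemma gal_transitive i j : exists2 g, g \in G & g (alpha i) = alpha j.
Proof.
apply: normalField_root_minPoly; rewrite ?sub1v ?memvf ?normalFieldf //.
have /polyOver1P [m Dm] : minPoly 1 (alpha i) \is a polyOver 1%VS by exact: minPolyOver.
rewrite Dm (@eqp_root _ _ (map_poly (in_alg L) f)); last first.
  rewrite eqp_map; case: irr_f => _; apply.
    rewrite -(size_map_poly (in_alg L)) -Dm size_minPoly eqSS.
    by rewrite adjoin_degreeE -lt0n divn_gt0 ?adim_gt0 // dimvS ?subv_adjoin.
  rewrite -(dvdp_map (in_alg L)) -Dm minPoly_dvdp //.
    by apply/polyOver1P; exists f.
  by apply/rootE; exists i.
by apply/rootE; exists j.
Qed.

(** Multiplicativity holds because automorphisms and permutations both compose left factor first. *)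
Lemma gal_root_perm : exists phi : {morphism G >-> {perm 'I_n}},
  forall g i, g \in G -> alpha (phi g i) = g (alpha i).
Proof.
have perm_ex (g : gal_of {:L}) : exists s : {perm 'I_n},
    [forall i, alpha (s i) == g (alpha i)].
  have idx i : {j | alpha j == g (alpha i)}.
    apply: sigW; have /rootE [j ->] : root (map_poly (in_alg L) f) (g (alpha i)).
      rewrite -[map_poly _ f](_ : map_poly g (map_poly (in_alg L) f) = _).
        by rewrite fmorph_root; apply/rootE; exists i.
      rewrite -map_poly_comp; apply: eq_map_poly => a /=.
      by rewrite linearZ rmorph1.
    by exists j.
  have s_inj : injective (fun i => sval (idx i)).
    move=> i j; case: (idx i) (idx j) => [k /= /eqP Dk] [k' /= /eqP Dk'] Ekk'.
    have : g (alpha i) = g (alpha j) by rewrite -Dk -Dk' Ekk'.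
    by move/fmorph_inj/alpha_inj.
  by exists (perm s_inj); apply/forallP => i; rewrite permE; case: (idx i).
pose phi g := sval (sigW (perm_ex g)).
have phiE g i : alpha (phi g i) = g (alpha i).
  by rewrite /phi; case: (sigW _) => s /= /forallP /(_ i) /eqP.
have phiM : {in G &, {morph phi : g h / (g * h)%g}}.
  move=> g h _ _; apply/permP => i; apply: alpha_inj.
  by rewrite permM !phiE galM ?memvf.
by exists (Morphism phiM) => g i _; apply: phiE.
Qed.

(* For n prime, a transposition and an n-cycle generate the symmetric group; the
   cycle comes from transitivity and Cauchy's theorem, and in the application the
   transposition is complex conjugation. *)
Lemma root_not_der_fixed (i0 j0 : 'I_n) (g0 : gal_of {:L}) :
    prime n -> (4 < n)%N -> i0 != j0 -> g0 \in G ->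
    (forall i, g0 (alpha i) = alpha (tperm i0 j0 i)) ->
  forall k i, alpha i \notin fixedField (G^`(k))%g.
Proof.
move=> pr_n n_gt4 ne_ij Gg0 g0E k i; apply/negP => /mem_fixedFieldP [_ fix_i].
have [phi phiE] := gal_root_perm.
have phi_g0 : phi g0 = tperm i0 j0.
  by apply/permP => j; apply: alpha_inj; rewrite phiE // g0E.
have trG : [transitive phi @* G, on [set: 'I_n] | 'P]%g.
  apply/imsetP; exists i0; rewrite ?inE //; apply/setP => j; rewrite inE.
  apply/esym/orbitP; have [g Gg gE] := gal_transitive i0 j.
  exists (phi g); first exact: mem_morphim.
  by apply: alpha_inj; rewrite /= apermE phiE.
have [c Gc oc] : {c | c \in (phi @* G)%g & #[c]%g = n}.
  by apply: Cauchy => //; have := atrans_dvd trG; rewrite cardsT card_ord.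
have phiG : (phi @* G)%g = [set: {perm 'I_n}].
  apply/eqP; rewrite eqEsubset subsetT /=.
  have <- : <<[set tperm i0 j0; c]>>%g = [set: {perm 'I_n}].
    by apply: gen_tperm_circular_shift; rewrite ?card_ord.
  rewrite gen_subG; apply/subsetP => s; rewrite !inE.
  by case/orP => /eqP -> //; rewrite -phi_g0 mem_morphim.
(* Write [alpha j] as [h (alpha i)]: the conjugate of [g] by the inverse of [h] stays in the normal
   derived group, so it fixes [alpha i], and [g] fixes [alpha j]. *)
have phi_der1 : (phi @* G^`(k))%g = 1%g.
  apply/trivgP/subsetP => _ /morphimP [g Gg kg ->]; apply/set1P/permP => j.
  rewrite perm1; apply: alpha_inj; rewrite phiE //.
  have [h Gh <-] := gal_transitive i j.
  rewrite -galM ?memvf // conjgCV galM ?memvf // fix_i // memJ_norm //.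
  by rewrite groupV (subsetP (der_norm k G)).
have sol_S : solvable (phi @* G)%g.
  by apply/derivedP; exists k; rewrite -morphim_der // phi_der1.
rewrite phiG in sol_S.
have : solvable 'Alt_('I_n) by apply: solvableS (subsetT _) sol_S.
by rewrite solvable_AltF // card_ord.
Qed.

End PrimeDegree.

Lemma conj_horner_ratr (C : numClosedFieldType) (p : {poly rat}) (y : C) :
  ((map_poly ratr p).[y])^* = (map_poly ratr p).[y^*].
Proof.
rewrite -horner_map -map_poly_comp; congr _.[_]; apply: eq_map_poly => a /=.
by rewrite fmorph_rat.
Qed.

(** The conjugate of the image of a primitive element is a root of the same minimal polynomial, so
    by normality it comes from an automorphism; the two maps then agree on all polynomials in that
    element. *)
Lemma gal_conj (L : splittingFieldType rat) (C : numClosedFieldType)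
    (iota : {rmorphism L -> C}) :
  exists2 g : gal_of {:L}, g \in 'Gal({:L} / 1)%g & forall x, iota (g x) = (iota x)^*.
Proof.
have [z gen_z] := num_field_primitive L.
have iota_horner (p : {poly rat}) (y : L) :
    iota (map_poly (in_alg L) p).[y] = (map_poly ratr p).[iota y].
  by rewrite -horner_map map_in_alg_rmorph.
have [rs /eqP Drs] := splitting_field_normal 1%AS z.
have /polyOver1P [m Dm] : minPoly 1 z \is a polyOver 1%VS by exact: minPolyOver.
have spl_m : splits L m by exists rs; rewrite -Dm Drs eqpxx.
have [z' Dz'] : exists z', iota z' = (iota z)^*.
  apply: (splits_root iota spl_m).
  by rewrite /root -conj_horner_ratr -iota_horner -Dm (rootP (root_minPoly _ _)) !rmorph0.
have [g Gg gz] : exists2 g, g \in 'Gal({:L} / 1)%g & g z = z'.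
  apply: normalField_root_minPoly; rewrite ?sub1v ?memvf ?normalFieldf //.
  rewrite /root Dm -(fmorph_eq0 iota) iota_horner Dz' -conj_horner_ratr -iota_horner -Dm.
  by rewrite (rootP (root_minPoly _ _)) !rmorph0.
exists g => // x; have [p ->] := gen_z x.
rewrite -horner_map -map_poly_comp (eq_map_poly (g := in_alg L)) => [|a]; last first.
  by rewrite /= linearZ rmorph1.
by rewrite !iota_horner conj_horner_ratr -Dz' -gz.
Qed.

(** Conjugation swaps [s] and [s^*] and fixes the other roots, hence gives the transposition for
    [root_not_der_fixed]. The field [L] splits [g * f] so that it both suits [x] and contains all
    roots of [f]. *)
Lemma prime_degree_not_radical (C : numClosedFieldType) (f : {poly rat}) (s : C) :
    irreducible_poly f -> prime (size f).-1 -> (4 < (size f).-1)%N ->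
    root (map_poly ratr f) s -> s^* != s ->
    (forall z : C, root (map_poly ratr f) z -> z^* != z -> z = s \/ z = s^*) ->
  forall x : C, root (map_poly ratr f) x -> ~ radical x.
Proof.
move=> irr_f; set n := (size f).-1 => pr_n n_gt4 fs nreal_s nreal_f x fx.
case/radical_der_fixed => g nz_g [k fix_x].
have nz_f := irredp_neq0 irr_f.
have [L spl] := splitting_field_exists (mulf_neq0 nz_g nz_f).
have [iota] := num_field_embed L C.
have [z Dz fix_z] := fix_x L iota (splits_dvd (dvdp_mulr f (dvdpp g)) spl).
have [rs Drs] := splits_dvd (dvdp_mull g (dvdpp f)) spl.
have sz_rs : size rs = n.
  have := eqp_size Drs; rewrite size_map_poly size_prod_XsubC => E.
  by rewrite /n E.
have uniq_rs : uniq rs.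
  rewrite -separable_prod_XsubC -(eqp_separable Drs) separable_map.
  rewrite separable_poly.unlock irreducible_poly_coprime //.
  suffices nz_f' : f^`() != 0.
    by apply/negP => /(dvdp_leq nz_f'); rewrite leqNgt lt_size_deriv.
  (* This coefficient of the derivative is [n] times the leading coefficient of [f], so it vanishes
     only for [n = 0], which is not prime. *)
  apply: contraTneq pr_n => /(congr1 (fun p : {poly rat} => p`_n.-1)).
  rewrite coef_deriv coef0 => /eqP; rewrite mulrn_eq0 prednK ?(ltn_trans _ n_gt4) //.
  by rewrite -lead_coefE lead_coef_eq0 (negPf nz_f) orbF => /eqP ->.
pose alpha (i : 'I_n) := rs`_i.
have alpha_inj : injective alpha.
  move=> i j /eqP; rewrite nth_uniq ?sz_rs // => /eqP; exact: val_inj.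
have Df : map_poly (in_alg L) f %= \prod_i ('X - (alpha i)%:P).
  by rewrite (eqp_trans Drs) // (big_nth 0) big_mkord sz_rs eqpxx.
have rsP y : root (map_poly ratr f) y -> exists i, iota (alpha i) = y.
  move=> fy; have [z' Dz'] := splits_root iota (ex_intro _ rs Drs) fy.
  have : z' \in rs.
    rewrite -root_prod_XsubC -(eqp_root Drs) -(fmorph_root iota).
    by rewrite map_in_alg_rmorph Dz'.
  case/(nthP 0) => i; rewrite sz_rs => lt_i Di.
  by exists (Ordinal lt_i); rewrite -Dz' -Di.
have alphaP i : root (map_poly ratr f) (iota (alpha i)).
  rewrite -(map_in_alg_rmorph iota) fmorph_root (eqp_root Drs) root_prod_XsubC.
  by rewrite mem_nth // sz_rs.
have [i Di] := rsP x fx.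
have [c Gc cE] := gal_conj iota.
have [i0 Di0] := rsP s fs.
have [j0 Dj0] : exists j, iota (alpha j) = s^*.
  by apply: rsP; rewrite /root -conj_horner_ratr (rootP fs) rmorph0.
have ne_ij : i0 != j0.
  by apply: contraNneq nreal_s => E; rewrite -Dj0 -E Di0.
have cT j : c (alpha j) = alpha (tperm i0 j0 j).
  apply: (fmorph_inj iota); rewrite cE.
  case: tpermP => [->|->|/eqP ne_i /eqP ne_j]; rewrite ?Di0 ?Dj0 ?conjCK //.
  apply/eqP/idPn => /(nreal_f _ (alphaP j)) [].
    by rewrite -Di0 => /fmorph_inj/alpha_inj/eqP; rewrite (negPf ne_i).
  by rewrite -Dj0 => /fmorph_inj/alpha_inj/eqP; rewrite (negPf ne_j).
have := root_not_der_fixed irr_f alpha_inj Df pr_n n_gt4 ne_ij Gc cT k i.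
by rewrite (_ : alpha i = z) ?fix_z //; apply: (fmorph_inj iota); rewrite Di Dz.
Qed.

(** * The quintic of the equilibrium *)

Definition quintic : {poly int} := Poly [:: 2; -3; -10; -14; 0; 1].

Lemma quinticE : quintic = [:: 2; -3; -10; -14; 0; 1] :> seq int.
Proof. by rewrite /quintic (@PolyK _ 0). Qed.

Lemma horner_quintic (K : comNzRingType) (x : K) :
  (map_poly intr quintic).[x] =
  x ^+ 5 - 14 * x ^+ 3 - 10 * x ^+ 2 - 3 * x + 2.
Proof.
have sz : (size (map_poly (intr : int -> K) quintic) <= 6)%N.
  by rewrite (leq_trans (size_poly _ _)) // quinticE.
rewrite (horner_coef_wide _ sz).
rewrite !big_ord_recl big_ord0 !coef_map !quinticE /bump /=.
ring.
Qed.

(** * Irreducibility of the quintic *)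

Lemma int_mul_eq1 (a b : int) : 1 = a * b -> a = 1 /\ b = 1 \/ a = - 1 /\ b = - 1.
Proof.
move=> E; have En : (1 = `|a| * `|b|)%N by rewrite -abszM -E.
have : (`|a|%N \in divisors 1) by rewrite -dvdn_divisors // En dvdn_mulr.
rewrite inE => /eqP Da; have [Ea|Ea] : a = 1 \/ a = - 1 by lia.
all: by move: E; rewrite Ea; lia.
Qed.

Lemma int_mul_eq2 (a b : int) : 2 = a * b ->
  [\/ a = 1 /\ b = 2, a = 2 /\ b = 1, a = - 1 /\ b = - 2 | a = - 2 /\ b = - 1].
Proof.
move=> E; have En : (2 = `|a| * `|b|)%N by rewrite -abszM -E.
have : (`|a|%N \in divisors 2) by rewrite -dvdn_divisors // En dvdn_mulr.
rewrite !inE => Da; have [Ea|[Ea|[Ea|Ea]]] : a = 1 \/ a = 2 \/ a = - 1 \/ a = - 2 by lia.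
- by apply: Or41; move: E; rewrite Ea; lia.
- by apply: Or42; move: E; rewrite Ea; lia.
- by apply: Or43; move: E; rewrite Ea; lia.
- by apply: Or44; move: E; rewrite Ea; lia.
Qed.

(* What remains of the coefficient equations of [quintic_no_coef], one quadratic
   for each of the four integer solutions of [a0 * b0 = 2]. *)
Lemma quad_no_root (x : int) :
  [&& x ^+ 2 + 2 * x - 12 != 0, 2 * x ^+ 2 + x - 29 != 0, x ^+ 2 + 2 * x - 16 != 0
    & 2 * x ^+ 2 + x - 27 != 0].
Proof.
(* Outside this range all four quadratics are positive; the 13 integers inside are checked by
   evaluation. *)
have [bd|bd] := boolP (- 7 < x < 7); last by apply/and4P; split; nia.
have : x \in [seq n%:Z - 6 | n <- iota 0%N 13%N].
  by apply/mapP; exists (absz (x + 6)); rewrite ?mem_iota; lia.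
by move: x {bd}; apply/allP.
Qed.

(** The last equation leaves a linear factor times a quartic ([a2 = 0]) or a quadratic times a cubic
    ([b4 = 0]). Leading coefficients are then 1 or -1 and the constant terms divide 2, so finitely
    many cases remain. *)
Lemma quintic_no_coef (a0 a1 a2 b0 b1 b2 b3 b4 : int) :
  2 = a0 * b0 -> - 3 = a0 * b1 + a1 * b0 -> - 10 = a0 * b2 + a1 * b1 + a2 * b0 ->
  - 14 = a0 * b3 + a1 * b2 + a2 * b1 -> 0 = a0 * b4 + a1 * b3 + a2 * b2 ->
  1 = a1 * b4 + a2 * b3 -> 0 = a2 * b4 -> False.
Proof.
move=> E0 E1 E2 E3 E4 E5 /esym/eqP; rewrite mulf_eq0 => /orP [] /eqP Z; subst.
  move: E5; rewrite mul0r addr0 => /int_mul_eq1 [] [? ?]; subst;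
  by case: (int_mul_eq2 E0) => [] [? ?]; subst; lia.
move: E5; rewrite mulr0 add0r => /int_mul_eq1 [] [? ?]; subst.
all: case: (int_mul_eq2 E0) => [] [? ?]; subst.
all: have /and4P [Q1 Q2 Q3 Q4] := quad_no_root a1.
all: have Db2 : b2 = a1 \/ b2 = - a1 by lia.
all: by case: Db2 => ?; subst; nia.
Qed.

(** Size is degree plus one: [a] has degree 1 or 2, so [b] has degree at most 4, and comparing
    coefficients gives the system of [quintic_no_coef]. *)
Lemma quintic_not_mul (a b : {poly int}) :
  (1 < size a <= 3)%N -> quintic <> a * b.
Proof.
move=> sz_a Dab.
have nz_ab : a * b != 0 by rewrite -Dab -size_poly_eq0 quinticE.
have sz_ab : (size a + size b = 7)%N.
  have [nz_a nz_b] : a != 0 /\ b != 0 by apply/andP; move: nz_ab; rewrite mulf_eq0 negb_or.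
  have := size_mul nz_a nz_b; rewrite -Dab quinticE /=.
  by move: (size a) (size b) => m n; lia.
have a_ge k : (2 < k)%N -> a`_k = 0.
  by case/andP: sz_a => _ sz_a lt2k; rewrite nth_default // (leq_trans sz_a).
have b_ge k : (4 < k)%N -> b`_k = 0.
  move=> lt4k; rewrite nth_default //; case/andP: sz_a sz_ab lt4k => + _.
  by move: (size a) (size b) => m n; lia.
have E k : quintic`_k = \sum_(i < k.+1) a`_i * b`_(k - i) by rewrite Dab coefM.
move: (E 0%N) (E 1%N) (E 2%N) (E 3%N) (E 4%N) (E 5%N) (E 6%N).
rewrite !big_ord_recr !big_ord0 !quinticE /= ?subSS ?subn0.
rewrite !(a_ge 3%N, a_ge 4%N, a_ge 5%N, a_ge 6%N, b_ge 5%N, b_ge 6%N) //.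
move=> E0 E1 E2 E3 E4 E5 E6.
rewrite !(mul0r, mulr0, addr0, add0r) in E0 E1 E2 E3 E4 E5 E6.
exact: (quintic_no_coef E0 E1 E2 E3 E4 E5 E6).
Qed.

(** Gauss's lemma gives integer factors; if neither is constant, one of them has degree 1 or 2. *)
Lemma quintic_irreducible : irreducible_poly (map_poly intr quintic : {poly rat}).
Proof.
have sz_q : size quintic = 6%N by rewrite quinticE.
have nz_q : quintic != 0 by rewrite -size_poly_eq0 sz_q.
split=> [|q0 sz_n1 /dvdpP_rat_int [q [c nz_c Dq0] [r Dq]]].
  by rewrite size_rat_int_poly sz_q.
rewrite {}Dq0 size_scale // size_rat_int_poly in sz_n1 *.
apply: eqp_trans (eqp_scale _ nz_c) _.
have nz_qr : q * r != 0 by rewrite -Dq.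
have [nz_a nz_b] : q != 0 /\ r != 0.
  by apply/andP; move: nz_qr; rewrite mulf_eq0 negb_or.
have sz_qr := size_mul nz_a nz_b; rewrite -Dq sz_q in sz_qr.
have [sz_lo|sz_hi] := boolP (1 < size q <= 3)%N.
  by case: (quintic_not_mul sz_lo Dq).
have [sz_lo'|sz_hi'] := boolP (1 < size r <= 3)%N.
  by exfalso; apply: (quintic_not_mul (b := q) sz_lo'); rewrite Dq mulrC.
rewrite -dvdp_size_eqp; last by rewrite dvdp_rat_int Dq dvdp_mulr.
rewrite !size_rat_int_poly sz_q.
rewrite -!size_poly_gt0 in nz_a nz_b.
move: (size q) (size r) => m n in sz_n1 sz_qr sz_hi sz_hi' nz_a nz_b *; lia.
Qed.

(** * Real and non-real roots of the quintic *)

Lemma quintic_ivt (R : rcfType) (a b : R) : a <= b ->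
  (map_poly intr quintic).[a] * (map_poly intr quintic).[b] < 0 ->
  exists2 r, a < r < b & root (map_poly intr quintic) r.
Proof.
move=> le_ab /(polyrcf.poly_ivtoo le_ab) [r]; rewrite in_itv => r_ab r0.
by exists r.
Qed.

(* The intervals are tight enough for the cofactor in [quintic_factor] to have a
   negative discriminant. *)
Lemma quintic_real_roots (R : rcfType) : exists r1 r2 r3 : R,
  [/\ - (34 / 10) < r1 < - (33 / 10), 28 / 100 < r2 < 29 / 100,
      407 / 100 < r3 < 408 / 100
    & all (root (map_poly intr quintic)) [:: r1; r2; r3]].
Proof.
have [r1 b1 f1] : exists2 r : R, - (34 / 10) < r < - (33 / 10) &
    root (map_poly intr quintic) r.
  by apply: quintic_ivt; rewrite ?horner_quintic; lra.
have [r2 b2 f2] : exists2 r : R, 28 / 100 < r < 29 / 100 &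
    root (map_poly intr quintic) r.
  by apply: quintic_ivt; rewrite ?horner_quintic; lra.
have [r3 b3 f3] : exists2 r : R, 407 / 100 < r < 408 / 100 &
    root (map_poly intr quintic) r.
  by apply: quintic_ivt; rewrite ?horner_quintic; lra.
by exists r1, r2, r3; split; rewrite //= f1 f2 f3.
Qed.

Lemma quintic_factor (R : rcfType) : exists r1 r2 r3 : R, exists q : {poly R},
  [/\ map_poly intr quintic = q * \prod_(r <- [:: r1; r2; r3]) ('X - r%:P),
      size q = 3%N, q`_2 = 1 & q`_1 ^+ 2 < 4 * q`_0 ].
Proof.
have [r1 [r2 [r3 [b1 b2 b3 rts]]]] := quintic_real_roots R.
exists r1, r2, r3.
have uniq_r : uniq_roots [:: r1; r2; r3].
  rewrite uniq_rootsE /= !inE negb_or andbT -andbA.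
  by apply/and3P; split; apply/eqP; lra.
have /dvdpP [q Dq] := uniq_roots_dvdp rts uniq_r.
exists q.
have sz_p : size (map_poly intr quintic : {poly R}) = 6%N.
  by rewrite size_map_inj_poly ?quinticE //; exact: intr_inj.
have sz_q : size q = 3%N.
  have nz_q : q != 0.
    by apply: contra_eq_neq Dq => ->; rewrite mul0r -size_poly_eq0 sz_p.
  have := size_Mmonic nz_q (monic_prod_XsubC [:: r1; r2; r3] xpredT id).
  by rewrite -Dq sz_p size_prod_XsubC addn4 => -[<-].
have E x : x ^+ 5 - 14 * x ^+ 3 - 10 * x ^+ 2 - 3 * x + 2 =
    (q`_0 + q`_1 * x + q`_2 * x ^+ 2) * ((x - r1) * (x - r2) * (x - r3)).
  rewrite -horner_quintic Dq hornerM horner_prod !big_cons big_nil !hornerXsubC.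
  rewrite (horner_coef_wide _ (n := 3%N)) ?sz_q //.
  rewrite !big_ord_recr big_ord0 /=; ring.
move: (q`_0) (q`_1) (q`_2) E => c b a E.
(* Six values determine a polynomial of degree at most 5, so the coefficients can be compared by
   linear arithmetic. *)
have [E0 E1 E2] := And3 (E 0) (E 1) (E (- 1)).
have [E3 E4 E5] := And3 (E 2) (E (- 2)) (E 3).
have Da : a = 1 by lra.
have Db : b = r1 + r2 + r3 by rewrite Da in E0 E1 E2 E3 E4 E5; lra.
have Dc : - c * (r1 * r2 * r3) = 2 by rewrite Da in E0 E1 E2 E3 E4 E5; lra.
split=> //.
(* The bounds place [b] between 0.95 and 1.07, while [c] exceeds 0.49 as [- 2] over the product of
   the roots; hence [b ^+ 2 < 1.15 < 1.96 < 4 * c]. *)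
have P23 : 0 < r2 * r3 < 119 / 100 by nra.
have P : - (405 / 100) < r1 * r2 * r3 < 0 by rewrite -mulrA; nra.
have c_gt : 49 / 100 < c by nra.
have b_lt : b ^+ 2 < 115 / 100 by rewrite Db; nra.
lra.
Qed.

Lemma conjC_fixed_real (R : rcfType) (z : R[i]) : z^* = z -> exists a : R, z = a%:C%C.
Proof.
case: z => a b /eqP; rewrite eq_complex /= eqxx /= => /eqP Eb.
by exists a; apply/eqP; rewrite eq_complex /= eqxx /=; apply/eqP; lra.
Qed.

Lemma map_ratr_quintic (R : rcfType) :
  map_poly ratr (map_poly intr quintic : {poly rat}) =
  map_poly (real_complex R) (map_poly intr quintic).
Proof.
rewrite -!map_poly_comp; apply: eq_map_poly => n /=.
by rewrite ratr_int rmorph_int.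
Qed.

(** Non-real roots belong to the quadratic cofactor, which is real with negative discriminant, so
    they form one conjugate pair. *)
Lemma quintic_conj_pair (R : rcfType) (p := map_poly intr quintic : {poly rat}) :
  exists2 s : R[i], root (map_poly ratr p) s /\ s^* != s &
    forall z : R[i], root (map_poly ratr p) z -> z^* != z -> z = s \/ z = s^*.
Proof.
have [r1 [r2 [r3 [q [Dq sz_q q2 q_disc]]]]] := quintic_factor R.
pose qC := map_poly (real_complex R) q.
have Dp : map_poly ratr p =
    qC * \prod_(r <- map (real_complex R) [:: r1; r2; r3]) ('X - r%:P).
  by rewrite /p map_ratr_quintic -map_prod_XsubC -rmorphM /= -Dq.
have qCE z : qC.[z] = z ^+ 2 + (q`_1)%:C%C * z + (q`_0)%:C%C.
  rewrite (horner_coef_wide _ (n := 3%N)) ?size_map_poly ?sz_q //.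
  by rewrite !big_ord_recr big_ord0 /= !coef_map /= q2; ring.
have conj_real (r : R) : (r%:C%C : R[i])^* = r%:C%C.
  by apply/eqP; rewrite eq_complex /= oppr0 !eqxx.
have real_r z : z \in map (real_complex R) [:: r1; r2; r3] -> z^* = z.
  by case/mapP => r _ ->; exact: conj_real.
have qC_nreal z : root qC z -> z^* != z.
  apply: contraTneq => /conjC_fixed_real [a ->].
  rewrite /qC fmorph_root (rootE q) (horner_coef_wide _ (n := 3%N)) ?sz_q //.
  rewrite !big_ord_recr big_ord0 /= q2; apply/eqP => E.
  have : 0 <= (2 * a + q`_1) ^+ 2 by exact: sqr_ge0.
  nra.
have [s qs] : exists s, root qC s by apply/closed_rootP; rewrite size_map_poly sz_q.
exists s; first by rewrite Dp rootM qs qC_nreal.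
have conj_root z : root qC z -> root qC z^*.
  move=> /rootP qz; rewrite rootE qCE -[(q`_1)%:C%C]conj_real -[(q`_0)%:C%C]conj_real.
  by rewrite -rmorphXn -rmorphM -!rmorphD -qCE qz rmorph0.
move=> z; rewrite Dp rootM root_prod_XsubC => /orP [qz _|/real_r ->]; last by rewrite eqxx.
(* The product is the difference of the equations of [y] and [s]. Applied to [z] and to [s^*], both
   different from [s], it gives them the same value. *)
have quad_root y : root qC y -> (y - s) * (y + s + (q`_1)%:C%C) = 0.
  move: qs; rewrite !rootE !qCE => /eqP Es /eqP Ey.
  transitivity (0 - 0 : R[i]); last by rewrite subrr.
  by rewrite -{1}Ey -Es; ring.
have [-> | ne_z] := eqVneq z s; [by left | right].
have := quad_root _ (conj_root _ qs); have := quad_root _ qz.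
move/eqP; rewrite mulf_eq0 subr_eq0 (negPf ne_z) /= => /eqP E1.
move/eqP; rewrite mulf_eq0 subr_eq0 (negPf (qC_nreal _ qs)) /= => /eqP E2.
by apply: (addIr (s + (q`_1)%:C%C)); rewrite !addrA E1 E2.
Qed.

(** * The equilibrium *)

(** Each operation preserves radicality, whichever k-th root is taken; decisions only select a
    branch. *)
Lemma rruns_radical (R : realType) (vs : seq R[i]) (t : rtree) (out : seq R[i]) :
  rruns vs t out -> {in vs, forall z, radical z} -> {in out, forall z, radical z}.
Proof.
elim=> {vs t out} [vs s /allP lt_s|vs o t w out step _ IH|vs i tp tn out _ _ _ IH
  |vs i tp tn out _ _ _ IH] // rad.
- by move=> _ /mapP [i /lt_s lt_i ->]; apply: rad; rewrite mem_nth.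
have rad_nth i : (i < size vs)%N -> radical vs`_i by move=> lt_i; apply/rad/mem_nth.
apply: IH => z; rewrite mem_rcons inE => /predU1P [-> | /rad //].
case: o step => [m|i j|i j|i j|i j|k i|i] /=.
- by move->; exact: radical_int.
- by case=> /rad_nth ri /rad_nth rj ->; exact: radicalD.
- by case=> /rad_nth ri /rad_nth rj ->; exact: radicalB.
- by case=> /rad_nth ri /rad_nth rj ->; exact: radicalM.
- by case=> /rad_nth ri /rad_nth rj _ ->; exact/radicalM/radicalV.
- by case=> k_gt0 /rad_nth ri wk; apply: (radical_root k_gt0); rewrite wk.
- by case=> /rad_nth ri ->; exact: radical_conj.
Qed.

Lemma radical_norm (C : numClosedFieldType) (z : C) : radical z -> radical `|z|.
Proof.
move=> rz; apply: (@radical_root _ 2) => //; rewrite normCK.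
by apply: radicalM => //; exact: radical_conj.
Qed.

Lemma normC_real (R : rcfType) (x : R) : `|x%:C%C| = (`|x|)%:C%C.
Proof. by rewrite normc_def /= expr0n addr0 sqrtr_sqr. Qed.

(** Squared norms of real numbers are plain squares, so absolute values survive only in the
    attraction. *)
Lemma FR_force_real (R : realType) (V : finType) (G : rel V) (y : V -> R) v :
  FR_force G (fun u => (y u)%:C%C) v =
  (\sum_(u | G v u) `|y u - y v| * (y u - y v) +
   \sum_(u | u != v) (y v - y u) / (y v - y u) ^+ 2)%:C%C.
Proof.
rewrite /FR_force rmorphD !rmorph_sum /=.
congr (_ + _); apply: eq_bigr => u _.
  by rewrite rmorphM rmorphB /= -normC_real rmorphB.
by rewrite -rmorphB normC_real -rmorphXn real_normK ?num_real // -fmorph_div.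
Qed.

(* All pairs of distinct vertices except {0, 3}. *)
Definition diamond : rel 'I_4 :=
  fun u v => [&& u != v, (u < v + 3)%N & (v < u + 3)%N].

Lemma diamond_simple : simple_graph diamond.
Proof.
split=> [u v|v]; last by rewrite /diamond eqxx.
by rewrite /diamond eq_sym [X in _ && X]andbC.
Qed.

(** For positive [x] and [t > 1] the vertices are numbered from left to right, so the non-adjacent
    pair 0, 3 is the outer one. *)
Definition line_pos (R : realType) (x t : R) (v : 'I_4) : R :=
  [:: - (t * x); - x; x; t * x]`_v.

Lemma cube_root (R : rcfType) (c : R) : 0 < c -> exists2 x, 0 < x & x ^+ 3 = c.
Proof.
move=> c_gt0; pose p := 'X^3 - c%:P.
have pE a : p.[a] = a ^+ 3 - c by rewrite /p !hornerE.
(* The upper end [c + 1] works because its cube exceeds [c]. *)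
have [||x x_in /rootP] := @polyrcf.poly_ivtoo _ p 0 (c + 1).
- lra.
- by rewrite !pE; nra.
rewrite pE => /eqP; rewrite subr_eq0 => /eqP xc; exists x => //.
by move: x_in; rewrite in_itv => /andP [].
Qed.

(** Mirror symmetry leaves one equation for the inner and one for the outer vertices. The choice of
    [x ^+ 3] solves the inner one; the quintic makes the outer one agree. *)
Lemma diamond_equilibrium (R : realType) (x t : R) :
    0 < x -> 4 < t -> root (map_poly intr quintic) t ->
    x ^+ 3 = (t ^+ 2 - 5) / (8 * (t ^+ 2 - 1) * (t + 1)) ->
  FR_equilibrium diamond (fun v => (line_pos x t v)%:C%C).
Proof.
move=> x_gt0 t_gt4 /rootP; rewrite horner_quintic => ft x3.
have tx : 4 * x < t * x by rewrite ltr_pM2r.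
have eq_in : 8 * (t ^+ 2 - 1) * (t + 1) * x ^+ 3 = t ^+ 2 - 5.
  by rewrite x3 mulrC divfK // lt0r_neq0 // !mulr_gt0 //; nra.
have eq_out : 4 * t * (t ^+ 2 - 1) * (t ^+ 2 + 1) * x ^+ 3 = 5 * t ^+ 2 - 1.
  have nz : 2 * (t + 1) != 0 by apply/eqP; lra.
  apply: (mulfI nz).
  (* The quintic is this product minus [2 * (t + 1) * (5 * t ^+ 2 - 1)]. *)
  transitivity (t * (t ^+ 2 + 1) * (t ^+ 2 - 5)); last by lra.
  rewrite -eq_in; ring.
(* Up to sign, the forces on the outer and on the inner vertices. *)
pose outer := (4 * t * (t ^+ 2 - 1) * (t ^+ 2 + 1) * x ^+ 3 - (5 * t ^+ 2 - 1)) /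
  (2 * t * (t ^+ 2 - 1) * x).
pose inner := (8 * (t ^+ 2 - 1) * (t + 1) * x ^+ 3 - (t ^+ 2 - 5)) /
  (2 * (t ^+ 2 - 1) * x).
have t2_gt1 : 1 < t ^+ 2 by nra.
have outer0 : outer = 0 by rewrite /outer eq_out subrr mul0r.
have inner0 : inner = 0 by rewrite /inner eq_in subrr mul0r.
split.
  move=> [[|[|[|[|//]]]] lt_u] [[|[|[|[|//]]]] lt_v] /(@complexI _);
  by rewrite /line_pos /= => E; try (exact: val_inj); exfalso; lra.
move=> v; rewrite FR_force_real; apply/eqP; rewrite eq_complex /= eqxx andbT.
rewrite big_mkcond [X in _ + X]big_mkcond /= !big_ord_recl !big_ord0.
case: v => [[|[|[|[|//]]]] lt_v]; rewrite /diamond /line_pos /=.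
- rewrite !ger0_norm; [|lra..].
  apply/eqP; transitivity outer => //; rewrite /outer; field.
  by do !(apply/andP; split); apply/eqP; nra.
- rewrite (@ler0_norm _ (- (t * x) - - x)) ?(@ger0_norm _ (x - - x))
    ?(@ger0_norm _ (t * x - - x)); [|lra..].
  apply/eqP; transitivity inner => //; rewrite /inner; field.
  by do !(apply/andP; split); apply/eqP; nra.
- rewrite (@ler0_norm _ (- (t * x) - x)) ?(@ler0_norm _ (- x - x))
    ?(@ger0_norm _ (t * x - x)); [|lra..].
  (* Vertex 2 mirrors vertex 1, so the force changes sign. *)
  apply/eqP; transitivity (- inner); last by rewrite inner0 oppr0.
  rewrite /inner; field.
  by do !(apply/andP; split); apply/eqP; nra.
- rewrite !ler0_norm; [|lra..].
  apply/eqP; transitivity (- outer); last by rewrite outer0 oppr0.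
  rewrite /outer; field.
  by do !(apply/andP; split); apply/eqP; nra.
Qed.

Theorem theorem3 (R : realType) :
  exists G : rel 'I_4, simple_graph G /\
    exists p : 'I_4 -> R[i], FR_equilibrium G p /\
      forall (t : rtree) (q : 'I_4 -> R[i]),
        rconstructs t q -> ~ congruent p q.
Proof.
(* The quintic is negative at 4 and positive at 5; [t > 4] makes the prescribed cube of [x]
   positive. *)
have [t /andP [t_gt4 _] ft] : exists2 t : R, 4 < t < 5 & root (map_poly intr quintic) t.
  by apply: quintic_ivt; rewrite ?horner_quintic; lra.
have c_gt0 : 0 < (t ^+ 2 - 5) / (8 * (t ^+ 2 - 1) * (t + 1)).
  by rewrite divr_gt0 ?mulr_gt0 //; nra.
have [x x_gt0 x3] := cube_root c_gt0.
exists diamond; split; first exact: diamond_simple.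
exists (fun v => (line_pos x t v)%:C%C); split; first exact: diamond_equilibrium.
move=> tr q run [f [iso_f qE]].
have rad_q v : radical (q v).
  apply: (rruns_radical run) => //; exact: map_f (mem_enum _ v).
(* Distances survive the isometry, so they are norms of differences of constructed coordinates. *)
have rad_dist u v : radical (`|line_pos x t u - line_pos x t v|%:C%C : R[i]).
  rewrite -normC_real rmorphB -iso_f -!qE.
  by apply: radical_norm; exact: radicalB.
have rad_t : radical (t%:C%C : R[i]).
  have := rad_dist (inord 3) (inord 0).
  have := rad_dist (inord 2) (inord 1).
  rewrite /line_pos !inordK //= !opprK !ger0_norm; [|nra..] => rad2 rad1.
  (* The outer distance over the inner one. *)
  have -> : t = (t * x + t * x) / (x + x) by field; apply/eqP; lra.
  by rewrite fmorph_div; apply: radicalM => //; exact: radicalV.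
have [s [fs s_nreal] conj_s] := quintic_conj_pair R.
apply: (prime_degree_not_radical quintic_irreducible _ _ fs s_nreal conj_s) rad_t.
- by rewrite size_rat_int_poly quinticE.
- by rewrite size_rat_int_poly quinticE.
by rewrite map_ratr_quintic fmorph_root.
Qed.
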